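(* Assume $(X,r)$ is a finite left non-degenerate idempotent set-theoretic solution of the Yang--Baxter equation. If $M=M(X,r)$ and $K$ is a field, then $K[M]$ is a finite (i.e. finitely generated) left module over a $K$-subalgebra that is isomorphic to a polynomial algebra in one variable over $K$. In particular, $K[M]$ is a left Noetherian representable algebra (and hence satisfies a polynomial identity) of Gelfand--Kirillov dimension one.
   Context: A set-theoretic solution of the Yang--Baxter equation is a pair $(X,r)$ with $X$ a non-empty set and $r\colon X\times X\to X\times X$ a map satisfying $(r\times\mathrm{id})(\mathrm{id}\times r)(r\times\mathrm{id})=(\mathrm{id}\times r)(r\times\mathrm{id})(\mathrm{id}\times r)$. Write $r(x,y)=(\lambda_x(y),\rho_y(x))$. It is finite if $X$ is finite, left non-degenerate if every $\lambda_x\colon X\to X$ is bijective, and idempotent if $r^2=r$. The structure monoid is $M(X,r)=\langle X\mid x\circ y=\lambda_x(y)\circ\rho_y(x),\ x,y\in X\rangle$ and $K[M]$ is its monoid algebra (structure algebra). A $K$-algebra is representable if it embeds as a $K$-algebra into a matrix algebra $M_n(L)$ over a field extension $L$ of $K$ for some $n\ge1$. *)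

(* Defs.v *)
From HB Require Import structures.
From mathcomp Require Import all_boot all_order all_algebra.
From mathcomp Require Import boolp classical_sets reals ereal sequences exp.
From mathcomp Require Import finmap.
(* The notations of monalg clash with those of MathComp-Analysis. *)
From mathcomp.multinomials Require Import -(notations) monalg.

Set Implicit Arguments.
Unset Strict Implicit.
Unset Printing Implicit Defensive.

Import GRing.Theory.

Local Open Scope classical_set_scope.
Local Open Scope ring_scope.
Local Open Scope quotient_scope.

(* r (x, y) = (lambda_x(y), rho_y(x)) = (lam x y, rho y x) *)

Section Solution.
Context {X : Type} (r : X * X -> X * X).

Definition lam (x y : X) : X := (r (x, y)).1.
Definition rho (y x : X) : X := (r (x, y)).2.

Definition r_id (t : X * X * X) : X * X * X := (r t.1, t.2).
Definition id_r (t : X * X * X) : X * X * X :=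
  let u := r (t.1.2, t.2) in (t.1.1, u.1, u.2).

Definition yang_baxter : Prop :=
  forall t, r_id (id_r (r_id t)) = id_r (r_id (id_r t)).

Definition left_nondegenerate : Prop := forall x, bijective (lam x).

Definition idempotent_solution : Prop := forall p, r (r p) = r p.

(* The congruence on the free monoid seq X generated by the defining relations
   of the structure monoid. *)
Inductive smcong : seq X -> seq X -> Prop :=
| smcong_rel u v x y :
    smcong (u ++ [:: x; y] ++ v) (u ++ [:: lam x y; rho y x] ++ v)
| smcong_refl u : smcong u u
| smcong_sym u v : smcong u v -> smcong v u
| smcong_trans u v w : smcong u v -> smcong v w -> smcong u w.

Lemma smcong_cat u u' v v' :
  smcong u u' -> smcong v v' -> smcong (u ++ v) (u' ++ v').
Proof.
move=> hu hv; apply: (@smcong_trans _ (u' ++ v)).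
  elim: hu => [a b x y|a|a b _|a b c _ h1 _ h2].
  - by rewrite -!catA; exact: (smcong_rel a (b ++ v) x y).
  - exact: smcong_refl.
  - exact: smcong_sym.
  - exact: smcong_trans h1 h2.
elim: hv => [a b x y|a|a b _|a b c _ h1 _ h2].
- by rewrite !(catA u'); exact: (smcong_rel (u' ++ a) b x y).
- exact: smcong_refl.
- exact: smcong_sym.
- exact: smcong_trans h1 h2.
Qed.

Lemma smcong_size u v : smcong u v -> size u = size v.
Proof. by elim=> // [a b x y|a b c _ -> _ ->]; rewrite ?size_cat. Qed.

End Solution.

Section StructureMonoid.
Context {X : choiceType} (r : X * X -> X * X).

Definition smeq (u v : seq X) : bool := `[< smcong r u v >].

Lemma smeq_refl : reflexive smeq.
Proof. by move=> u; apply/asboolP; exact: smcong_refl. Qed.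

Lemma smeq_sym : symmetric smeq.
Proof. by move=> u v; apply/asboolP/asboolP; exact: smcong_sym. Qed.

Lemma smeq_trans : transitive smeq.
Proof.
by move=> v u w /asboolP h1 /asboolP h2; apply/asboolP; exact: smcong_trans h2.
Qed.

Canonical smeq_equiv := EquivRel smeq smeq_refl smeq_sym smeq_trans.

Definition structure_monoid : Type := {eq_quot smeq_equiv}.

HB.instance Definition _ := Choice.on structure_monoid.
HB.instance Definition _ := EqQuotient.on structure_monoid.

Definition sm_one : structure_monoid := \pi_structure_monoid [::].
Definition sm_mul (a b : structure_monoid) : structure_monoid :=
  \pi_structure_monoid (repr a ++ repr b).

Lemma sm_eqP u v : reflect (smcong r u v) (u == v %[mod structure_monoid]).
Proof. by rewrite eqmodE; exact: asboolP. Qed.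

Lemma sm_repr u : smcong r (repr (\pi_structure_monoid u)) u.
Proof. by apply/sm_eqP; rewrite reprK. Qed.

Lemma sm_mul_pi u v :
  sm_mul (\pi_structure_monoid u) (\pi_structure_monoid v)
  = \pi_structure_monoid (u ++ v).
Proof. by apply/eqP/sm_eqP; apply: smcong_cat; exact: sm_repr. Qed.

Lemma sm_mulA : associative sm_mul.
Proof.
elim/quotW=> u; elim/quotW=> v; elim/quotW=> w.
by rewrite (sm_mul_pi v w) (sm_mul_pi u v) !sm_mul_pi catA.
Qed.

Lemma sm_mul1m : left_id sm_one sm_mul.
Proof. by elim/quotW=> u; rewrite sm_mul_pi. Qed.

Lemma sm_mulm1 : right_id sm_one sm_mul.
Proof. by elim/quotW=> u; rewrite sm_mul_pi cats0. Qed.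

Lemma sm_unitm a b : sm_mul a b = sm_one -> a = sm_one /\ b = sm_one.
Proof.
elim/quotW: a => u; elim/quotW: b => v.
rewrite sm_mul_pi => /eqP/sm_eqP/smcong_size.
by case: u v => [|? ?] [|? ?].
Qed.

HB.instance Definition _ := Choice_isMonomialDef.Build structure_monoid
  sm_mulA sm_mul1m sm_mulm1 sm_unitm.

End StructureMonoid.

Arguments structure_monoid {X} r.

Section StructureAlgebra.
Context (K : fieldType) {X : choiceType} (r : X * X -> X * X).

Definition structure_algebra : Type := malg (structure_monoid r) K.

HB.instance Definition _ := GRing.Lalgebra.on structure_algebra.

Lemma structure_algebra_scalerAr (k : K) (a b : structure_algebra) :
  k *: (a * b) = a * (k *: b).
Proof.
rewrite (malgMEw (fsubset_refl (msupp a)) (msuppZ_le k b)).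
rewrite malgME scaler_sumr; apply: eq_bigr => m1 _.
rewrite scaler_sumr; apply: eq_bigr => m2 _.
apply/malgP => m; rewrite mcoeffZ !mcoeffU mcoeffZ.
by rewrite mulrnAr mulrCA.
Qed.

HB.instance Definition _ := GRing.Lalgebra_isAlgebra.Build K structure_algebra
  structure_algebra_scalerAr.

End StructureAlgebra.

Section Algebra.
Context {K : fieldType} (A : algType K).

Definition is_subalgebra (B : set A) : Prop := GRing.subalg_closed (mem B).

Definition iso_poly1 (B : set A) : Prop :=
  exists2 f : {lrmorphism {poly K} -> A}, injective f & range f = B.

Definition finite_left_module_over (B : set A) : Prop :=
  exists n (e : 'I_n -> A), forall a, exists2 b : 'I_n -> A,
    (forall i, B (b i)) & a = \sum_(i < n) b i * e i.

Definition left_ideal (I : set A) : Prop :=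
  [/\ I 0, (forall a b, I a -> I b -> I (a + b))
    & forall a b, I b -> I (a * b)].

Definition left_noetherian : Prop :=
  forall I : nat -> set A,
    (forall n, left_ideal (I n)) -> (forall n, I n `<=` I n.+1) ->
    exists n, forall m, (n <= m)%N -> I m = I n.

Definition representable : Prop :=
  exists (L : fieldType) (iota : {rmorphism K -> L}) (n : nat)
    (f : {rmorphism A -> 'M[L]_n.+1}),
    injective f /\ forall (k : K) (a : A), f (k *: a) = iota k *: f a.

(* The free K-algebra on countably many generators is the monoid algebra of
   the free monoid on nat; free_eval v substitutes v i for the generator i. *)
Definition free_eval (v : nat -> A) (p : malg (fmonom nat) K) : A :=
  mmap (fun c : K => c%:A)
       (fun m : fmonom nat => \prod_(i <- (m : seq nat)) v i) p.

Definition satisfies_PI : Prop :=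
  exists2 p : malg (fmonom nat) K, p != 0 & forall v, free_eval v p = 0.

Definition span (S : set A) : set A :=
  [set a | exists n (x : 'I_n -> A) (c : 'I_n -> K),
    (forall i, S (x i)) /\ a = \sum_(i < n) c i *: x i].

Definition lin_indep n (x : 'I_n -> A) : Prop :=
  forall c : 'I_n -> K, \sum_(i < n) c i *: x i = 0 -> forall i, c i = 0.

(* Only used on finite-dimensional V. *)
Definition dim (V : set A) : nat :=
  get [set d | exists2 x : 'I_d -> A, lin_indep x & span (range x) = V].

(* V^0 + V^1 + ... + V^n, with V^0 = K. *)
Definition powers (V : set A) (n : nat) : set A :=
  span [set a | exists s : seq A,
    [/\ (size s <= n)%N, {in s, forall x, V x} & a = \prod_(x <- s) x]].

Definition fin_dim_subspace (V : set A) : Prop :=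
  exists s : seq A, V = span [set` s].

(* sup over V of limsup_n log_n (dim (V^0 + ... + V^n)) *)
Definition GKdim (R : realType) : \bar R :=
  ereal_sup [set limn_esup
      (fun n : nat => (ln (dim (powers V n))%:R / ln n%:R : R)%:E)
    | V in fin_dim_subspace].

End Algebra.

Arguments GKdim {K} A R.

(* Main.v *)
(* Idempotence gives [rho_y(x) = q (lam_x(y))], where [q z] is the preimage of
   [z] under [lam_z].  The value [lam_{x_1} ... lam_{x_(n-1)} (x_n)] of a word is
   invariant under the defining relations, and every word of length [n >= 1] and
   value [z] is equal in [M] to [z (q z) ... (q^(n-1) z)].  So [M] is
   [{1}] together with one element [(z, n)] for each [z] in [X] and [n >= 1], and
   left multiplication by [t = x_0^d], with [d] the order of [lam_{x_0}], sends
   [(z, n)] to [(z, n + d)]: the elements of length at most [d] generate [K[M]]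
   as a left module over [K[t]].
   - Noetherianity: in an increasing chain of submodules of [K[t]^N] the spaces of
     leading coefficients in degree [n] increase with [n] and along the chain,
     hence stabilise uniformly.
   - Representability: [M] acts on the right on the finite set [X * X^X], and an
     element of [M] is determined by its length and by the image of one state;
     so [m |-> s^|m| P_m], with [P_m] the matrix of the action of [m], is faithful
     on [K[M]].
   - Polynomial identity: the standard polynomial, being multilinear and
     alternating, vanishes on [M_n(L)] as soon as its degree exceeds [n^2].
   - Gelfand-Kirillov dimension: there are at most [(k + 1) #|X|] elements of length
     at most [k], and the powers of a letter are linearly independent. *)

Require Import Defs.
From mathcomp Require Import all_boot all_order all_algebra.
From mathcomp Require Import boolp classical_sets reals ereal.
From HB Require Import structures.
From mathcomp Require Import fingroup perm fraction sequences exp normedtype.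
From mathcomp.multinomials Require Import -(notations) monalg.

Set Implicit Arguments.
Unset Strict Implicit.
Unset Printing Implicit Defensive.

Import Order.TTheory GRing.Theory Num.Theory.

Local Open Scope ring_scope.

(** * Chains of submodules of a free module over K[t] *)

Lemma ex_max_of_bounded (T : Type) (f : T -> nat) (N : nat) (x0 : T) :
  (forall x, (f x <= N)%N) -> exists x, forall y, (f y <= f x)%N.
Proof.
move=> f_le.
pose P := [pred n : nat | `[< exists x, f x = n >]].
have exP : exists n, P n by exists (f x0); apply/asboolP; exists x0.
have P_le n : P n -> (n <= N)%N by move=> /asboolP[x <-].
case: (ex_maxnP exP P_le) => n /asboolP[x <-] max_x.
by exists x => y; apply: max_x; apply/asboolP; exists y.
Qed.

(** A subspace of maximal dimension inside [W] is all of [W]: adjoining the line through any vector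
    of [W] cannot enlarge it. *)
Lemma linear_set_vspace (K : fieldType) (vT : vectType K) (W : set vT) :
  W 0 -> (forall c u v, W u -> W v -> W (c *: u + v)) ->
  exists U : {vspace vT}, forall v, v \in U <-> W v.
Proof.
move=> W0 Wlin.
pose T := {U : {vspace vT} | forall v, v \in U -> W v}.
have T0 : T by exists 0%VS => v; rewrite memv0 => /eqP ->.
have [|[U UW] maxU] := @ex_max_of_bounded T (fun U => \dim (sval U)) (\dim {:vT}) T0.
  by move=> U; exact/dimvS/subvf.
exists U => v; split=> [|Wv]; first exact: (UW v).
have UvW w : w \in (U + <[v]>)%VS -> W w.
  move=> /memv_addP[u uU [_ /vlineP[c ->] ->]].
  by rewrite addrC; apply: Wlin => //; exact: (UW u).
have /= dimUv := maxU (exist _ _ UvW).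
have : (U + <[v]> <= U)%VS.
  by have /eqP <- : U == (U + <[v]>)%VS by rewrite eqEdim dimUv addvSl.
by move=> /subvP/(_ v); apply; apply: (subvP (addvSr U _)); exact: memv_line.
Qed.

(** The dimension attains its maximum at some [(n0, k0)], so [U] is constant on the quadrant beyond
    it. The finitely many rows below [n0] each stabilise, and a maximum of the bounds serves for
    all. *)
Lemma double_chain_stable (K : fieldType) (vT : vectType K)
    (U : nat -> nat -> {vspace vT}) :
  (forall n k, (U n k <= U n.+1 k)%VS) -> (forall n k, (U n k <= U n k.+1)%VS) ->
  exists k0, forall n k, (k0 <= k)%N -> U n k = U n k0.
Proof.
move=> Un Uk.
have leUk n k k' : (k <= k')%N -> (U n k <= U n k')%VS.
  by apply: (homo_leq (r := fun V W => (V <= W)%VS)) => // ? ? ? /subv_trans; apply.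
have leUn n n' k : (n <= n')%N -> (U n k <= U n' k)%VS.
  apply: (homo_leq (f := U^~ k) (r := fun V W => (V <= W)%VS)) => //.
  by move=> ? ? ? /subv_trans; apply.
have dimU (p : nat * nat) : (\dim (U p.1 p.2) <= \dim {:vT})%N.
  exact/dimvS/subvf.
have [[n0 k0] /= max0] := ex_max_of_bounded (0%N, 0%N) dimU.
have stable n : (n0 <= n)%N -> forall k, (k0 <= k)%N -> U n k = U n0 k0.
  move=> n0n k k0k; apply/esym/eqP; rewrite eqEdim (max0 (n, k)) andbT.
  exact: subv_trans (leUk _ _ _ k0k) (leUn _ _ _ n0n).
have [k1 k1P] : exists k1, forall n, (n < n0)%N ->
    forall k, (k1 <= k)%N -> U n k = U n k1.
  elim: (n0) => [|m [k1 k1P]]; first by exists 0%N.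
  have [k2 max2] := ex_max_of_bounded 0%N (fun k => dimU (m, k)).
  have k2P k : (k2 <= k)%N -> U m k = U m k2.
    by move=> k2k; apply/esym/eqP; rewrite eqEdim max2 andbT leUk.
  exists (maxn k1 k2) => n; rewrite ltnS leq_eqVlt => nm k.
  rewrite geq_max => /andP[k1k k2k].
  case/orP: nm => [/eqP ->|nm].
    by rewrite [LHS]k2P // [RHS]k2P // leq_maxr.
  by rewrite [LHS]k1P // [RHS]k1P // leq_maxl.
exists (maxn k0 k1) => n k; rewrite geq_max => /andP[k0k k1k].
have [n0n|nn0] := leqP n0 n.
  by rewrite [LHS]stable // [RHS]stable // leq_maxl.
by rewrite [LHS]k1P // [RHS]k1P // leq_maxr.
Qed.

Section PolyChain.
Context (K : fieldType) (N : nat) (S : nat -> set 'rV[{poly K}]_N).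
Hypothesis S0 : forall k, S k 0.
Hypothesis SD : forall k a b, S k a -> S k b -> S k (a + b).
Hypothesis SZ : forall k p a, S k a -> S k (p *: a).
Hypothesis S_incr : forall k, (S k `<=` S k.+1)%classic.

(** Only a bound on the degree is imposed, not equality, so that these coefficient vectors form a
    linear set. *)
Definition leading_forms n k : set 'rV[K]_N :=
  [set v | exists2 a, S k a &
    forall i, (size (a 0%R i) <= n.+1)%N /\ (a 0 i)`_n = v 0 i].

Lemma poly_chain_stable : exists k0, forall k, (k0 <= k)%N -> S k = S k0.
Proof.
have lfP n k : exists U : {vspace 'rV[K]_N}, forall v, v \in U <-> leading_forms n k v.
  apply: linear_set_vspace.
    by exists 0 => // i; rewrite !mxE size_poly0 coef0.
  move=> c u v [a Sa au] [b Sb bv]; exists (c%:P *: a + b).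
    by apply: SD => //; exact: SZ.
  move=> i; rewrite !mxE mul_polyC coefD coefZ (au i).2 (bv i).2; split=> //.
  rewrite (leq_trans (size_polyD _ _)) // geq_max (bv i).1 andbT.
  exact: leq_trans (size_scale_leq _ _) (au i).1.
pose U n k := sval (cid (lfP n k)).
have UP n k v : v \in U n k <-> leading_forms n k v by rewrite /U; case: cid => ? /=.
have [||k0 k0P] := @double_chain_stable K _ U.
(* Multiplication by ['X] shifts a leading form from degree [n] to [n.+1]. *)
- move=> n k; apply/subvP => v /UP[a Sa av]; apply/UP; exists ('X *: a).
    exact: SZ.
  move=> i; rewrite !mxE coefXM /= (av i).2; split=> //.
  by rewrite (leq_trans (size_polyMleq _ _)) // size_polyX add2n ltnS (av i).1.
- move=> n k; apply/subvP => v /UP[a Sa av]; apply/UP; exists a => //.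
  exact: S_incr.
exists k0 => k k0k.
have Sk0k : (S k0 `<=` S k)%classic.
  rewrite -(subnKC k0k); elim: (k - k0)%N => [|m IH]; first by rewrite addn0.
  by rewrite addnS => v /IH; exact: S_incr.
apply/seteqP; split=> // a Sa.
have [n] : exists n, forall i, (size (a 0%R i) <= n)%N.
  by exists (\max_i size (a 0%R i))%N => i; exact: leq_bigmax.
(* Induction on the degree bound: subtracting some [b] of [S k0] with the same leading form as [a]
   lowers the degree. *)
elim: n a Sa => [|n IH] a Sa a_le.
  suff -> : a = 0 by [].
  apply/rowP => i; rewrite mxE; apply/eqP.
  by rewrite -size_poly_eq0 -leqn0.
have : \row_i (a 0 i)`_n \in U n k.
  by apply/UP; exists a => // i; rewrite mxE.
rewrite k0P // => /UP[b Sb ba].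
rewrite -(subrK b a); apply: (SD _ Sb); apply: IH.
  by apply: SD => //; rewrite -scaleN1r; apply/SZ/Sk0k.
move=> i; apply/leq_sizeP => j; rewrite !mxE coefB leq_eqVlt => /orP[/eqP <-|nj].
  by rewrite (ba i).2 mxE subrr.
by rewrite !nth_default ?subrr // (leq_trans _ nj) // (ba i).1.
Qed.

End PolyChain.

(** The chain is pulled back along the surjection [ev] from a free module over [{poly K}]; left
    ideals become submodules, and surjectivity transfers stability back. *)
Lemma left_noetherian_of_finite (K : fieldType) (A : algType K) (B : set A) :
  iso_poly1 B -> finite_left_module_over B -> left_noetherian A.
Proof.
move=> [f _ fB] [n [e eP]] I idealI I_incr.
pose ev (p : 'rV[{poly K}]_n) : A := \sum_i f (p 0 i) * e i.
have ev_surj a : exists p, ev p = a.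
  have [b Bb ->] := eP a.
  have {}Bb i : exists q, f q = b i by have := Bb i; rewrite -fB => -[q _ <-]; exists q.
  exists (\row_i sval (cid (Bb i))); apply: eq_bigr => i _.
  by rewrite mxE; case: cid => q /= ->.
have [||||k0 k0P] := @poly_chain_stable K n (fun k => [set p | I k (ev p)]%classic).
- move=> k /=; rewrite /ev big1; first by case: (idealI k).
  by move=> i _; rewrite mxE rmorph0 mul0r.
- move=> k p q /= Ip Iq; suff -> : ev (p + q) = ev p + ev q.
    by case: (idealI k) => _ + _; apply.
  by rewrite -big_split; apply: eq_bigr => i _; rewrite mxE rmorphD mulrDl.
- move=> k p q /= Iq; suff -> : ev (p *: q) = f p * ev q.
    by case: (idealI k) => _ _; apply.
  by rewrite mulr_sumr; apply: eq_bigr => i _; rewrite mxE rmorphM mulrA.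
- by move=> k p; exact: I_incr.
exists k0 => k k0k; apply/funext => a; have [p <-] := ev_surj a.
by have /(congr1 (fun S => S p)) := k0P k k0k.
Qed.

(** * Dimension and growth *)

Local Notation dim := Defs.dim.
Local Notation span := Defs.span.

Section Dimension.
Context (K : fieldType) (A : algType K).
Implicit Types (S W : set A).

Definition linear_set W : Prop :=
  W 0 /\ forall c a b, W a -> W b -> W (c *: a + b).

Lemma linear_set_sum W (I : Type) (s : seq I) (F : I -> A) (c : I -> K) :
  linear_set W -> (forall i, W (F i)) -> W (\sum_(i <- s) c i *: F i).
Proof.
move=> [W0 Wlin] WF; elim: s => [|i s IH]; first by rewrite big_nil.
by rewrite big_cons; exact: Wlin.
Qed.

Lemma linear_set_span S : linear_set (span S).
Proof.
split; first by exists 0%N, (fun=> 0), (fun=> 0); rewrite big_ord0; split=> // -[].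
move=> c _ _ [n [x [a [Sx ->]]]] [m [y [b [Sy ->]]]].
exists (n + m)%N, (fun i => match split i with inl j => x j | inr j => y j end),
  (fun i => match split i with inl j => c * a j | inr j => b j end).
split=> [i|]; first by case: split.
rewrite big_split_ord scaler_sumr; congr (_ + _); apply: eq_bigr => i _.
  by rewrite (unsplitK (inl _ i)) scalerA.
by rewrite (unsplitK (inr _ i)).
Qed.

Lemma sub_span S : (S `<=` span S)%classic.
Proof.
move=> a Sa; exists 1%N, (fun=> a), (fun=> 1).
by rewrite big_ord1 scale1r.
Qed.

Lemma span_sub_linear S W : linear_set W -> (S `<=` W)%classic -> (span S `<=` W)%classic.
Proof.
by move=> linW SW _ [n [x [c [Sx ->]]]]; apply: linear_set_sum => // i; exact: SW.
Qed.

Lemma span_mul S T W a b : linear_set W -> (forall x y, S x -> T y -> W (x * y)) ->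
  span S a -> span T b -> W (a * b).
Proof.
move=> linW STW [n [x [c [Sx ->]]]] [m [y [d [Ty ->]]]].
rewrite mulr_suml; under eq_bigr do rewrite -scalerAl.
apply: linear_set_sum => // i; rewrite mulr_sumr.
under eq_bigr do rewrite -scalerAr.
by apply: linear_set_sum => // j; exact: STW.
Qed.

Lemma span_range (I : finType) (e : I -> A) a :
  span (range e) a -> exists c : I -> K, a = \sum_i c i *: e i.
Proof.
move=> [n [x [c [Sx ->]]]].
have {}Sx i : exists j, e j = x i by have [j _] := Sx i; exists j.
pose g i := sval (cid (Sx i)).
have gE i : e (g i) = x i by rewrite /g; case: cid.
exists (fun j => \sum_(i | g i == j) c i).
rewrite (partition_big g xpredT) //=; apply: eq_bigr => j _.
by rewrite scaler_suml; apply: eq_bigr => i /eqP <-; rewrite gE.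
Qed.

(** With more vectors than generators, the coefficient matrix has a nonzero left kernel vector,
    which is a linear relation. *)
Lemma lin_indep_leq (I : finType) (e : I -> A) d (x : 'I_d -> A) :
  lin_indep x -> (forall i, span (range e) (x i)) -> (d <= #|I|)%N.
Proof.
move=> x_free xe; rewrite leqNgt; apply/negP => lt_d.
pose c i := sval (cid (span_range (xe i))).
pose C := \matrix_(i < d, j < #|I|) c i (enum_val j).
have xE i : x i = \sum_(j < #|I|) C i j *: e (enum_val j).
  under eq_bigr do rewrite mxE.
  by rewrite -(big_enum_val (A := I) (fun j => c i j *: e j)) /c; case: cid.
have : kermx C != 0.
  by rewrite kermx_eq0 /row_free neq_ltn (leq_ltn_trans (rank_leq_col _)).
move=> /rowV0Pn[u /sub_kermxP uC]; apply/negP; rewrite negbK; apply/eqP/rowP => i.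
rewrite mxE; apply: x_free i.
under eq_bigr do rewrite xE scaler_sumr.
rewrite exchange_big big1 // => j _ /=.
under eq_bigr do rewrite scalerA.
rewrite -scaler_suml.
have /rowP/(_ j) := uC; rewrite !mxE => ->; exact: scale0r.
Qed.

(** Since [dim] is chosen by [get], a basis must be exhibited before its value means anything. A
    longest independent family in [W] exists because lengths are bounded by [#|I|], and it spans
    [W]. *)
Lemma dimP (I : finType) (e : I -> A) W : linear_set W ->
  (W `<=` span (range e))%classic ->
  exists2 x : 'I_(dim W) -> A, lin_indep x & span (range x) = W.
Proof.
move=> linW We; rewrite /dim.
apply: (@getPex _
  [set d | exists2 x : 'I_d -> A, lin_indep x & span (range x) = W]%classic).
pose T := {d & {x : 'I_d -> A | lin_indep x & forall i, W (x i)}}.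
have T0 : T by exists 0%N, (fun=> 0) => [c _|] [].
have [|[d [x x_free Wx]] /= maxd] := @ex_max_of_bounded T (@projT1 _ _) #|I| T0.
  move=> [d [x x_free Wx]] /=; apply: (lin_indep_leq (e := e) x_free) => i.
  exact: We.
exists d, x => //; apply/seteqP; split.
  by apply: span_sub_linear => // _ [i _ <-].
move=> a Wa; apply: contrapT => xa.
pose y (i : 'I_d.+1) := if unlift ord0 i is Some j then x j else a.
have y0 : y ord0 = a by rewrite /y unlift_none.
have yS j : y (lift ord0 j) = x j by rewrite /y liftK.
have y_free : lin_indep y.
  move=> c; rewrite big_ord_recl y0.
  under eq_bigr do rewrite yS.
  have [c0|c0] := eqVneq (c ord0) 0.
    rewrite c0 scale0r add0r => /x_free cx i.
    by case: (unliftP ord0 i) => [j ->|->].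
  move=> /eqP; rewrite addr_eq0 => /eqP cE; exfalso; apply: xa.
  have [lin0 lin] := linear_set_span (range x).
  rewrite -(scalerK c0 a) cE scalerN -scaleNr -[X in span _ X]addr0.
  apply: (lin _ _ _ _ lin0); apply: linear_set_sum; first exact: linear_set_span.
  by move=> j; apply: sub_span; exists j.
have Wy i : W (y i) by rewrite /y; case: unlift.
by have := maxd (existT _ d.+1 (exist2 _ _ y y_free Wy)); rewrite /= ltnn.
Qed.

Lemma dim_leq (I : finType) (e : I -> A) W : linear_set W ->
  (W `<=` span (range e))%classic -> (dim W <= #|I|)%N.
Proof.
move=> linW We; have [x x_free xW] := dimP linW We.
apply: (lin_indep_leq (e := e) x_free) => i; apply: We.
by rewrite -xW; apply: sub_span; exists i.
Qed.

Lemma dim_geq (I : finType) (e : I -> A) W d (x : 'I_d -> A) : linear_set W ->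
  (W `<=` span (range e))%classic -> lin_indep x -> (forall i, W (x i)) ->
  (d <= dim W)%N.
Proof.
move=> linW We x_free Wx; have [y y_free yW] := dimP linW We.
by have := lin_indep_leq (e := y) x_free; rewrite yW card_ord; apply.
Qed.

End Dimension.

(** * Gelfand--Kirillov dimension of linear growth *)

Section GelfandKirillov.
Context (R : realType).

Lemma limn_esup_ln_ratio_le (d : nat -> nat) (C : nat) :
  (forall n, (0 < n)%N -> (0 < d n <= C * n)%N) ->
  (limn_esup (fun n => (ln (d n)%:R / ln n%:R : R)%:E) <= 1)%E.
Proof.
move=> dC; apply/lee_addgt0Pr => eps eps0.
(* From [N] on, [ln C <= eps * ln n], hence [ln (C * n) <= (1 + eps) * ln n]; the second successor
   gives [N >= 2], so that [ln n > 0]. *)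
pose N := (Num.truncn (expR (ln C%:R / eps : R))).+2.
have N_gt n : (N <= n)%N -> expR (ln C%:R / eps : R) < n%:R.
  move=> Nn; apply: lt_le_trans (truncnS_gt _) _.
  by rewrite ler_nat (leq_trans _ Nn).
rewrite /limn_esup limf_esupE; apply: ge_ereal_inf.
exists (ereal_sup
    [set (ln (d n)%:R / ln n%:R : R)%:E | n in [set n | (N <= n)%N]])%classic.
  by exists [set n | (N <= n)%N]%classic => //; exists N.
apply: ge_ereal_sup => _ [n /= Nn <-]; rewrite -EFinD lee_fin.
have n1 : (1 < n)%N by apply: leq_trans Nn.
have lnn : 0 < ln n%:R :> R by rewrite ln_gt0 // ltr1n.
have /andP[d0 dn] := dC _ (ltnW n1).
have C0 : (0 < C)%N by move: (leq_trans d0 dn); rewrite muln_gt0 => /andP[].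
rewrite ler_pdivrMr // mulrDl mul1r addrC.
apply: (@le_trans _ _ (ln (C * n)%:R)).
  by rewrite ler_ln ?posrE ?ltr0n ?muln_gt0 ?C0 ?(ltnW n1) ?ler_nat.
rewrite natrM lnM ?posrE ?ltr0n ?(ltnW n1) // lerD2r.
rewrite mulrC -ler_pdivrMr // -[leLHS]expRK ler_ln ?posrE ?expR_gt0 ?ltr0n ?(ltnW n1) //.
exact/ltW/N_gt.
Qed.

Lemma limn_esup_ln_ratio_ge (d : nat -> nat) :
  (forall n, (n <= d n)%N) ->
  (1 <= limn_esup (fun n => (ln (d n)%:R / ln n%:R : R)%:E))%E.
Proof.
move=> dn; rewrite /limn_esup limf_esupE.
apply: le_ereal_inf_tmp => _ [V [N _ NV] <-].
pose n := maxn N 2.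
apply: (@le_trans _ _ (ln (d n)%:R / ln n%:R)%:E); last first.
  by apply: ereal_sup_ubound; exists n => //; apply: NV; rewrite /= leq_maxl.
have n1 : (1 < n)%N by rewrite leq_maxr.
rewrite lee_fin ler_pdivlMr ?ln_gt0 ?ltr1n // mul1r.
by rewrite ler_ln ?posrE ?ltr0n ?ler_nat // ?(ltnW n1) // (leq_trans _ (dn n)) // ltnW.
Qed.

Context (K : fieldType) (A : algType K).

Lemma GKdim_ge1 (t : A) :
  (forall n, lin_indep (fun i : 'I_n => t ^+ i)) -> (1 <= GKdim A R)%E.
Proof.
move=> t_free; pose V := span [set` [:: t]]%classic.
apply: (@le_trans _ _
    (limn_esup (fun n => (ln (dim (powers V n))%:R / ln n%:R : R)%:E))); last first.
  by apply: ereal_sup_ubound; exists V => //; exists [:: t].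
apply: limn_esup_ln_ratio_ge => n.
(* The [n] powers below [t ^+ n] bound the dimension from below; the span of the powers up to
   [t ^+ n] supplies the finite generating family. *)
apply: (@dim_geq _ _ _ (fun i : 'I_n.+1 => t ^+ i) _ _ (fun i : 'I_n => t ^+ i)) => //.
- exact: linear_set_span.
- apply: span_sub_linear; first exact: linear_set_span.
  move=> _ [s [s_le sV ->]].
  have [c ->] : exists c, \prod_(x <- s) x = c *: t ^+ size s.
    elim: s sV {s_le} => [|x s IH] sV.
      by exists 1; rewrite big_nil scale1r.
    have [|c cE] := IH; first by move=> y ys; apply: sV; rewrite inE ys orbT.
    have [b ->] : exists b, x = b *: t.
      have [m [y [b [yt ->]]]] : V x by apply: sV; rewrite inE eqxx.
      exists (\sum_i b i); rewrite scaler_suml; apply: eq_bigr => i _.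
      by have := yt i; rewrite /= inE => /eqP ->.
    by exists (b * c); rewrite big_cons cE -scalerAl -scalerAr scalerA exprS.
  have [lin0 lin] := linear_set_span (range (fun i : 'I_n.+1 => t ^+ i)).
  rewrite -[X in span _ X]addr0; apply: lin => //; apply: sub_span.
  have ltsn : (size s < n.+1)%N by [].
  by exists (Ordinal ltsn).
- move=> i; apply: sub_span; exists (nseq i t); split.
  + by rewrite size_nseq ltnW.
  + move=> x /nseqP[-> _]; apply: sub_span; exact: mem_head.
  + by rewrite big_nseq -Monoid.iteropE /=.
Qed.

(** If the generating space lies in [W c], products of at most [n] of its elements lie in
    [W (c * n)], whose dimension is at most [C * (c * n + 1) <= C * (c + 1) * n] for [n >= 1]. *)
Lemma GKdim_le1 (W : nat -> set A) (C : nat) :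
  (forall k, linear_set (W k)) -> (forall j k, (j <= k)%N -> (W j `<=` W k)%classic) ->
  W 0%N 1 -> (forall j k a b, W j a -> W k b -> W (j + k)%N (a * b)) ->
  (forall a, exists k, W k a) ->
  (forall k, exists2 I : finType, (#|I| <= C * k.+1)%N &
     exists e : I -> A, (W k `<=` span (range e))%classic) ->
  (GKdim A R <= 1)%E.
Proof.
move=> linW Wmono W1 WM Wex Wfin.
apply: ge_ereal_sup => _ [V [s ->] <-].
have [c sW] : exists c, (span [set` s] `<=` W c)%classic.
  have [c cP] : exists c, forall a, a \in s -> W c a.
    elim: s => [|a s [c cP]]; first by exists 0%N.
    have [k Wa] := Wex a; exists (maxn c k) => b; rewrite inE => /orP[/eqP ->|/cP Wb].
      by apply: Wmono Wa; rewrite leq_maxr.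
    by apply: Wmono Wb; rewrite leq_maxl.
  by exists c; apply: span_sub_linear.
have powW n : (powers (span [set` s]) n `<=` W (c * n)%N)%classic.
  apply: span_sub_linear => // _ [u [u_le uV ->]].
  apply: (Wmono (c * size u)%N); first by rewrite leq_mul2l u_le orbT.
  elim: u uV {u_le} => [|x u IH] uV; first by rewrite big_nil muln0.
  rewrite big_cons mulnS; apply: WM; first by apply/sW/uV; rewrite inE eqxx.
  by apply: IH => y yu; apply: uV; rewrite inE yu orbT.
apply: (limn_esup_ln_ratio_le (C := C * c.+1)) => n n0.
have [I I_le [e We]] := Wfin (c * n)%N.
apply/andP; split.
  apply: (@dim_geq _ _ _ e _ _ (fun _ : 'I_1 => 1)) => //.
  - exact: linear_set_span.
  - by move=> a /powW /We.
  - move=> b; rewrite big_ord1 => /eqP; rewrite scaler_eq0 oner_eq0 orbF => /eqP b0 i.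
    by rewrite ord1.
  - by move=> _; apply: sub_span; exists [::]; rewrite big_nil.
apply: (@leq_trans #|I|).
  apply: (dim_leq (e := e)); first exact: linear_set_span.
  by move=> a /powW /We.
apply: leq_trans I_le _; rewrite -mulnA leq_mul2l; apply/orP; right.
by rewrite mulSn addnC -addn1 leq_add2l.
Qed.

End GelfandKirillov.

(** * The standard identity *)

Section StandardIdentity.
Context (L : fieldType) (n k : nat).
Implicit Type x : 'I_k -> 'M[L]_n.+1.

Definition standard_sum x : 'M[L]_n.+1 :=
  \sum_(s : 'S_k) (-1) ^+ s *: \prod_(i < k) x (s i).

(** The permutations [s] and [s * t] carry opposite signs and equal products, so the terms cancel in
    pairs; this works in every characteristic. *)
Lemma standard_sum_alternate x j1 j2 :
  j1 != j2 -> x j1 = x j2 -> standard_sum x = 0.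
Proof.
move=> j12 xj12; pose t := tperm j1 j2.
have odd_t s : (s * t)%g = ~~ s :> bool by rewrite odd_permM odd_tperm j12 addbT.
rewrite /standard_sum (bigID (@odd_perm _)) /=.
apply: canLR (subrK _) _; rewrite add0r -sumrN.
rewrite (reindex_inj (mulIg t)); apply: eq_big => //= s.
rewrite odd_t => /negPf ->; rewrite scaleN1r scale1r; congr (- _).
apply: eq_bigr => i _; rewrite permM /t.
by case: tpermP => // ->.
Qed.

(** More than [n.+1 * n.+1] matrices satisfy a relation with some nonzero coefficient [c 0 j0].
    Putting the relation into slot [j0] gives 0 and, by multilinearity and alternation, also
    [c 0 j0] times the sum. *)
Lemma standard_sum_eq0 x : (n.+1 * n.+1 < k)%N -> standard_sum x = 0.
Proof.
move=> lt_k.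
pose M := \matrix_i mxvec (x i).
have [c c0 cM] : exists2 c : 'rV[L]_k, c != 0 & c *m M = 0.
  have : kermx M != 0.
    by rewrite kermx_eq0 /row_free neq_ltn (leq_ltn_trans (rank_leq_col _)).
  by move=> /rowV0Pn[c /sub_kermxP cM c0]; exists c.
have [j0 cj0] : exists j, c 0 j != 0.
  apply/existsP; apply: contraR c0; rewrite negb_exists => /forallP c0.
  by apply/eqP/rowP => j; rewrite mxE; apply/eqP; have := c0 j; rewrite negbK.
have cx0 : \sum_j c 0 j *: x j = 0.
  apply: (can_inj mxvecK); rewrite linear_sum linear0 -[RHS]cM mulmx_sum_row.
  by apply: eq_bigr => j _; rewrite linearZ rowK.
pose x' y j := if j == j0 then y else x j.
(* Linearity in slot [j0]: the factor [y] occurs once, at position [s^-1 j0], where the index list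
   is split. *)
have prodE (s : 'S_k) : exists a b : 'M[L]_n.+1, forall y,
    \prod_(i < k) x' y (s i) = a * y * b.
  have j0_enum : (s^-1)%g j0 \in index_enum 'I_k by rewrite mem_index_enum.
  have := index_enum_uniq 'I_k; case/splitPr: j0_enum => p1 p2.
  rewrite cat_uniq /= => /and3P[_].
  rewrite negb_or => /andP[p1j _] /andP[p2j _].
  exists (\prod_(i <- p1) x (s i)), (\prod_(i <- p2) x (s i)) => y.
  rewrite big_cat big_cons /= /x' permKV eqxx mulrA.
  have neq i : i != (s^-1)%g j0 -> (s i == j0) = false.
    by apply: contraNF => /eqP <-; rewrite permK.
  congr (_ * _ * _); apply: eq_big_seq => i ip; rewrite neq //.
    by apply: contraNneq p1j => <-.
  by apply: contraNneq p2j => <-.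
have sumE : standard_sum (x' (\sum_j c 0 j *: x j))
    = \sum_j c 0 j *: standard_sum (x' (x j)).
  rewrite /standard_sum; under [RHS]eq_bigr do rewrite scaler_sumr.
  rewrite exchange_big; apply: eq_bigr => s _ /=.
  have [a [b abE]] := prodE s; rewrite abE mulr_sumr mulr_suml scaler_sumr.
  by apply: eq_bigr => j _; rewrite abE -scalerAr -scalerAl !scalerA mulrC.
move: sumE; rewrite cx0 (bigD1 j0) //= [X in _ + X]big1 ?addr0.
  have -> : x' (x j0) = x by apply/funext => j; rewrite /x'; case: eqP => // ->.
  suff -> : standard_sum (x' 0) = 0.
    by move=> /esym/eqP; rewrite scaler_eq0 (negPf cj0) => /eqP.
  rewrite /standard_sum big1 // => s _.
  by have [a [b ->]] := prodE s; rewrite mulr0 mul0r scaler0.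
move=> j jj0; rewrite (@standard_sum_alternate _ j j0) ?scaler0 //.
by rewrite /x' eqxx (negPf jj0).
Qed.

End StandardIdentity.

Section StandardPolynomial.
Context (K : fieldType) (k : nat).

Definition standard_word (s : 'S_k) : fmonom nat :=
  FMonom [seq val (s i) | i <- index_enum 'I_k].

Definition standard_poly : malg (fmonom nat) K :=
  \sum_(s : 'S_k) mkmalgU (standard_word s) ((-1) ^+ s).

Lemma standard_word_inj : injective standard_word.
Proof.
move=> s s' [/eq_in_map ss']; apply/permP => i.
by apply/val_inj/ss'; rewrite mem_index_enum.
Qed.

Lemma standard_poly_neq0 : standard_poly != 0.
Proof.
apply/eqP => /(congr1 (mcoeff (standard_word 1))).
rewrite mcoeff0 raddf_sum (bigD1 (1%g : 'S_k)) //= mcoeffUU odd_perm1 big1 ?addr0.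
  by move/eqP; rewrite oner_eq0.
by move=> s s1; rewrite mcoeffU (inj_eq standard_word_inj) (negPf s1).
Qed.

Lemma free_eval_standard_poly (A : algType K) (v : nat -> A) :
  free_eval v standard_poly =
  \sum_(s : 'S_k) (-1) ^+ s *: \prod_(i < k) v (s i).
Proof.
(* Written with [in_alg], the evaluation is recognised as additive. *)
have -> : free_eval v =
    mmap (in_alg A) (fun m : fmonom nat => \prod_(i <- (m : seq nat)) v i).
  by [].
rewrite raddf_sum; apply: eq_bigr => s _.
by rewrite /= mmapU /= mulr_algl big_map.
Qed.

End StandardPolynomial.

Lemma representable_PI (K : fieldType) (A : algType K) :
  representable A -> satisfies_PI A.
Proof.
move=> [L [iota [n [f [f_inj fZ]]]]]; pose k := (n.+1 * n.+1).+1.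
exists (standard_poly K k); first exact: standard_poly_neq0.
move=> v; apply: f_inj; rewrite rmorph0 free_eval_standard_poly.
rewrite -(@standard_sum_eq0 L n k (fun i => f (v i))) // rmorph_sum.
by apply: eq_bigr => s _; rewrite fZ rmorph_sign rmorph_prod.
Qed.

(** * Words in the structure monoid *)

Section NormalForm.
Context (X : finType) (r : X * X -> X * X).
Hypothesis r_yang_baxter : yang_baxter r.
Hypothesis r_left_nondegenerate : left_nondegenerate r.
Hypothesis r_idempotent : idempotent_solution r.

Lemma lam_inj x : injective (lam r x).
Proof. exact: bij_inj. Qed.

(** The map [q] of the introduction; [finv] is the inverse of an injective self-map of a finite
    type. *)
Definition diag_inv (z : X) : X := finv (lam r z) z.

Lemma lam_diag_inv z : lam r z (diag_inv z) = z.
Proof. exact: f_finv (@lam_inj z) z. Qed.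

(** The first component of [r (r (x, y)) = r (x, y)] says that [lam] at [lam r x y] fixes that point
    as the image of [rho r y x]. *)
Lemma rhoE x y : rho r y x = diag_inv (lam r x y).
Proof.
apply: (@lam_inj (lam r x y)); rewrite lam_diag_inv.
by have /(congr1 fst) := r_idempotent (x, y); rewrite [r (x, y)]surjective_pairing.
Qed.

Lemma lam_lam x y w : lam r (lam r x y) (lam r (rho r y x) w) = lam r x (lam r y w).
Proof. by have /(congr1 (fun t => t.1.1)) := r_yang_baxter (x, y, w). Qed.

(** Middle component of the Yang--Baxter equation at [(x, x, w)] with [z = lam r x w], every [rho]
    being rewritten by [rhoE]. It computes the value of the tail met when a word is put in normal
    form. *)
Lemma lam_diag_inv_lam x z :
  lam r (diag_inv (lam r x z)) (diag_inv z) = diag_inv (lam r x z).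
Proof.
have [w ->] : exists w, z = lam r x w.
  by exists (finv (lam r x) z); rewrite f_finv //; exact: lam_inj.
have yb : rho r (lam r (rho r x x) w) (lam r x x)
    = lam r (rho r (lam r x w) x) (rho r w x).
  exact: (congr1 (fun t => t.1.2) (r_yang_baxter (x, x, w))).
by rewrite -(rhoE x (lam r x w)) -(rhoE x w) -yb rhoE lam_lam -rhoE.
Qed.

Lemma smcong_foldr_lam u v : smcong r u v ->
  forall y, foldr (lam r) y u = foldr (lam r) y v.
Proof.
elim=> // [a b x y|a b c _ IH1 _ IH2] w.
- by rewrite !foldr_cat /= lam_lam.
- by rewrite IH1.
Qed.

(* The value of a nonempty word, with junk value [x0] on the empty one *)
Definition word_value x0 (u : seq X) : X :=
  if rev u is y :: v then foldr (lam r) y (rev v) else x0.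

Lemma word_value_rcons x0 u y : word_value x0 (rcons u y) = foldr (lam r) y u.
Proof. by rewrite /word_value rev_rcons revK. Qed.

Lemma word_value_cat x0 u v : v != [::] ->
  word_value x0 (u ++ v) = foldr (lam r) (word_value x0 v) u.
Proof.
case/lastP: v => // v y _.
by rewrite -rcons_cat !word_value_rcons foldr_cat.
Qed.

Lemma smcong_word_value x0 u v : smcong r u v -> word_value x0 u = word_value x0 v.
Proof.
elim=> // [a b x y|a b c _ -> _ ->//].
(* Before a nonempty tail the relation preserves the action. At the end of the word, the new pair is
   some [z] followed by [q z], of value [z]. *)
case: (eqVneq b [::]) => [->|b0]; last first.
  by rewrite !catA !word_value_cat // !foldr_cat /= lam_lam.
rewrite !cats0 !word_value_cat // -![[:: _; _]]/(rcons [:: _] _).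
by rewrite !word_value_rcons /= rhoE lam_diag_inv.
Qed.

Lemma word_value_traject x0 z n : word_value x0 (traject diag_inv z n.+1) = z.
Proof.
elim: n z => [|n IH] z; first by rewrite (word_value_rcons _ [::]).
by rewrite trajectS -cat1s word_value_cat // IH /= lam_diag_inv.
Qed.

(** Induction on length, used twice: the tail [v] is normalised, the relation turns the first two
    letters [x z] into [z' (q z')], and the rest [w], of value [q z'], is normalised again. *)
Lemma smcong_traject x0 u : u != [::] ->
  smcong r u (traject diag_inv (word_value x0 u) (size u)).
Proof.
have [n] := ubnP (size u); elim: n u => // n IH [//|x [|y u]] /= lt_un _.
  exact: smcong_refl.
set v := y :: u in lt_un *.
have v0 : v != [::] by [].
set z := word_value x0 v.
apply: (@smcong_trans _ _ _ ([:: x] ++ traject diag_inv z (size v))).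
  by apply: (@smcong_cat _ _ [:: x]); [exact: smcong_refl | exact: IH].
rewrite -(cat1s x v) word_value_cat //= -/z.
set z' := lam r x z.
have := smcong_rel r [::] (traject diag_inv (diag_inv z) (size u)) x z.
rewrite /= rhoE -/z' => /smcong_trans; apply.
apply: (@smcong_cat _ _ [:: z'] [:: z']); first exact: smcong_refl.
set w := _ :: traject _ _ _.
have /IH : (size w < n)%N by rewrite /w /= size_traject.
move=> /(_ isT); rewrite {2}/w /= size_traject.
suff -> : word_value x0 w = diag_inv z' by [].
rewrite /w; case: (size u) => [|k]; first by rewrite (word_value_rcons _ [::]).
by rewrite -cat1s word_value_cat // word_value_traject /= lam_diag_inv_lam.
Qed.

Lemma smcongP x0 u v :
  smcong r u v <-> size u = size v /\ word_value x0 u = word_value x0 v.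
Proof.
split=> [uv|[suv uv]].
  by split; [exact: smcong_size uv | exact: smcong_word_value].
case: (eqVneq u [::]) suv => [-> |u0].
  by case: v {uv} => // _; exact: smcong_refl.
case: (eqVneq v [::]) => [->|v0 suv]; first by case: u u0 {uv}.
apply: smcong_trans (smcong_traject x0 u0) _.
by rewrite uv suv; apply/smcong_sym/smcong_traject.
Qed.

End NormalForm.

(** * The structure algebra *)

Section PolyEval.
Context (K : fieldType) (A : algType K) (t : A).

(* [horner_alg t] itself is only declared linear for the scaling
   [c, a |-> c%:A * a], not for [*:%R]. *)
Definition poly_eval : {poly K} -> A := horner_alg t.

HB.instance Definition _ := GRing.RMorphism.copy poly_eval (horner_alg t).

Fact poly_eval_scalable : scalable poly_eval.
Proof. by move=> c p; rewrite /poly_eval linearZ /= mulr_algl. Qed.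

HB.instance Definition _ :=
  GRing.isScalable.Build K {poly K} A *:%R poly_eval poly_eval_scalable.

Lemma poly_evalX : poly_eval 'X = t.
Proof. exact: horner_algX. Qed.

End PolyEval.

Section StructureAlgebra.
Context (K : fieldType) (X : finType) (r : X * X -> X * X).
Hypothesis r_yang_baxter : yang_baxter r.
Hypothesis r_left_nondegenerate : left_nondegenerate r.
Hypothesis r_idempotent : idempotent_solution r.
Context (x0 : X).

Local Notation A := (structure_algebra K r).
Local Notation word_value := (word_value r x0).

Definition word_class (u : seq X) : structure_monoid r := \pi_(structure_monoid r)%qT u.

Definition mono (u : seq X) : A := mkmalgU (word_class u) 1.

Lemma word_class_eq u v : (word_class u == word_class v) =
  (size u == size v) && (word_value u == word_value v).
Proof.
have uvP := smcongP r_yang_baxter r_left_nondegenerate r_idempotent x0 u v.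
apply/(sm_eqP r u v)/andP => [/uvP[-> ->]|[/eqP ? /eqP ?]]; first by rewrite !eqxx.
exact/uvP.
Qed.

Lemma mcoeff_mono u v : mcoeff (word_class v) (mono u) =
  ((size u == size v) && (word_value u == word_value v))%:R.
Proof. by rewrite mcoeffU word_class_eq. Qed.

Lemma eq_mono u v : size u = size v -> word_value u = word_value v -> mono u = mono v.
Proof.
by move=> suv uv; congr mkmalgU; apply/eqP; rewrite word_class_eq suv uv !eqxx.
Qed.

Lemma mono_nil : mono [::] = 1.
Proof. by []. Qed.

Lemma mono_cat u v : mono (u ++ v) = mono u * mono v.
Proof.
rewrite /mono malgM_def; have := @fgmulUU _ K 1 1 (word_class u) (word_class v).
by rewrite mulr1 /word_class -sm_mul_pi => <-.
Qed.

Lemma mono_exp w i : exists2 v, size v = (size w * i)%N & mono w ^+ i = mono v.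
Proof.
elim: i => [|i [v sv vE]]; first by exists [::]; rewrite ?muln0 ?expr0.
by exists (w ++ v); rewrite ?size_cat ?sv ?mulnS // exprS vE mono_cat.
Qed.

Lemma structure_algebra_ind (W : set A) :
  linear_set W -> (forall u, W (mono u)) -> forall a, W a.
Proof.
move=> linW Wmono a.
have -> : a = \sum_(m <- finmap.enum_fset (msupp a))
    mcoeff m a *: mono (generic_quotient.repr m).
  rewrite {1}[a]monalgE; apply: eq_bigr => m _.
  apply/malgP => k; rewrite mcoeffZ !mcoeffU mulr_natr.
  by rewrite /word_class reprK.
exact: linear_set_sum.
Qed.

(** The element [(z, n)] of the introduction. At length 0 every [z] gives 1, so the family spans but
    may repeat. *)
Definition canonical_mono k (p : 'I_k.+1 * X) : A :=
  mono (traject (diag_inv r) p.2 p.1).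

Lemma mono_canonical k u : (size u <= k)%N ->
  exists p, mono u = canonical_mono (k := k) p.
Proof.
move=> uk; have uk1 : (size u < k.+1)%N by [].
exists (Ordinal uk1, word_value u); apply: eq_mono; first by rewrite size_traject.
by rewrite /=; case: (u) => [|y v] //; rewrite word_value_traject.
Qed.

(** Powers of a nonempty word have pairwise distinct lengths, hence are distinct monomials. *)
Lemma mono_powers_lin_indep w : w != [::] ->
  forall n, lin_indep (fun i : 'I_n => mono w ^+ i).
Proof.
move=> w0 n c c_sum i; have [v sv vE] := mono_exp w i.
have /(congr1 (mcoeff (word_class v))) := c_sum.
rewrite mcoeff0 raddf_sum (bigD1 i) //= vE mcoeffZ mcoeff_mono !eqxx mulr1.
rewrite big1 ?addr0 // => j ji.
have [v' sv' ->] := mono_exp w j.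
rewrite mcoeffZ mcoeff_mono sv sv' eqn_pmul2l ?lt0n ?size_eq0 //.
by rewrite (inj_eq val_inj) (negPf ji) mulr0.
Qed.

Lemma poly_eval_mono_inj w : w != [::] -> injective (poly_eval (mono w)).
Proof.
move=> w0; apply: raddf_inj => p p0; apply/polyP => i; rewrite coef0.
have [ip|ip] := ltnP i (size p); last by rewrite nth_default.
apply: (@mono_powers_lin_indep w w0 (size p) (fun j => p`_j) _ (Ordinal ip)).
rewrite -[RHS]p0 -[in RHS](coefK p) poly_def raddf_sum /=.
by apply: eq_bigr => j _; rewrite linearZ /= rmorphXn /= poly_evalX.
Qed.

(** * Finiteness over a polynomial subalgebra *)

Lemma lam_iter_id x : exists2 d, (0 < d)%N & forall y, iter d (lam r x) y = y.
Proof.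
pose s := perm (lam_inj r_left_nondegenerate (x := x)).
exists #[s]%g; first exact: order_gt0.
move=> y; have /permP/(_ y) := expg_order s.
rewrite permX perm1 => {2}<-; apply: eq_iter => z.
by rewrite permE.
Qed.

Lemma structure_algebra_finite_module :
  exists B : set A, [/\ is_subalgebra B, iso_poly1 B & finite_left_module_over B].
Proof.
have [d d0 lam_d] := lam_iter_id x0.
pose t := mono (nseq d x0).
have t0 : nseq d x0 != [::] by case: (d) d0.
(* Prefixing [d] letters [x0] does not change the value, so [u] equals [t] times the normal form of
   the same value and length [size u - d]; this length is positive, so the value is not the junk
   one. *)
have mono_t u : (d < size u)%N -> exists2 v, (size v < size u)%N & mono u = t * mono v.
  move=> du; set v := traject (diag_inv r) (word_value u) (size u - d).
  have sv : size v = (size u - d)%N by rewrite size_traject.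
  have v0 : v != [::] by rewrite -size_eq0 sv subn_eq0 -ltnNge.
  exists v; first by rewrite sv ltn_subrL d0 (leq_trans _ du).
  rewrite -mono_cat; apply: eq_mono.
    by rewrite size_cat size_nseq sv subnKC // ltnW.
  rewrite word_value_cat // /v -(prednK (_ : 0 < size u - d)%N) ?subn_gt0 //.
  rewrite word_value_traject //.
  rewrite -[in LHS](lam_d (word_value u)).
  by elim: (d) => //= k ->.
exists (range (poly_eval t)); split.
- split.
  + by apply/mem_set; exists 1 => //; exact: rmorph1.
  + move=> c a b /set_mem[p _ <-] /set_mem[q _ <-]; apply/mem_set.
    by exists (c *: p + q) => //; rewrite linearP.
  + move=> a b /set_mem[p _ <-] /set_mem[q _ <-]; apply/mem_set.
    by exists (p * q) => //; rewrite rmorphM.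
- by exists (poly_eval t); first exact: poly_eval_mono_inj.
pose I : finType := ('I_d.+1 * X)%type.
suff ex_coef : forall a : A, exists p : I -> {poly K},
    a = \sum_i poly_eval t (p i) * canonical_mono i.
  exists #|I|, (fun i => canonical_mono (enum_val i)) => a.
  have [p ->] := ex_coef a; exists (fun i => poly_eval t (p (enum_val i))).
    by move=> i; exists (p (enum_val i)).
  by rewrite [LHS](big_enum_val (A := I)).
apply: structure_algebra_ind.
  split; first by exists (fun=> 0); rewrite big1 // => i _; rewrite rmorph0 mul0r.
  move=> c _ _ [p ->] [q ->]; exists (fun i => c *: p i + q i).
  rewrite scaler_sumr -big_split; apply: eq_bigr => i _ /=.
  by rewrite linearP /= mulrDl scalerAl.
(* Factors [t] are split off, each contributing an ['X] to the coefficients, until the length is at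
   most [d]. *)
move=> u; have [n] := ubnP (size u); elim: n u => // n IH u un.
have [ud|du] := leqP (size u) d.
  have [i ->] := mono_canonical ud; exists (fun j => (j == i)%:R).
  rewrite (bigD1 i) //= eqxx rmorph1 mul1r big1 ?addr0 // => j /negPf ->.
  by rewrite rmorph0 mul0r.
have [v vu ->] := mono_t _ du; have [|p ->] := IH v; first exact: leq_trans vu un.
exists (fun i => 'X * p i); rewrite mulr_sumr; apply: eq_bigr => i _.
by rewrite rmorphM /= poly_evalX mulrA.
Qed.

(** * Linear growth of the structure algebra *)

Lemma structure_algebra_GKdim (R : realType) : GKdim A R = 1%:E.
Proof.
apply/eqP; rewrite eq_le; apply/andP; split; last first.
  by apply: (@GKdim_ge1 R K A (mono [:: x0])); exact: mono_powers_lin_indep.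
(* The filtration by length; [W k] is spanned by the [k.+1 * #|X|] canonical monomials. *)
pose W k : set A := span [set mono u | u in [set u | (size u <= k)%N]]%classic.
have linW k : linear_set (W k) by exact: linear_set_span.
have W_mono u k : (size u <= k)%N -> W k (mono u).
  by move=> uk; apply: sub_span; exists u.
have leW j k : (j <= k)%N -> (W j `<=` W k)%classic.
  move=> jk; apply: span_sub_linear => // _ [u uj <-].
  exact/W_mono/(leq_trans uj).
apply: (@GKdim_le1 R K A W #|X|) => //.
- by rewrite -mono_nil; exact: W_mono.
- move=> j k a b; apply: span_mul => // _ _ [u uj <-] [v vk <-].
  by rewrite -mono_cat; apply: W_mono; rewrite size_cat leq_add.
- apply: structure_algebra_ind; last by move=> u; exists (size u); exact: W_mono.
  split; first by exists 0%N; case: (linW 0%N).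
  move=> c a b [j Wa] [k Wb]; exists (maxn j k); case: (linW (maxn j k)) => _; apply.
    by apply: leW Wa; rewrite leq_maxl.
  by apply: leW Wb; rewrite leq_maxr.
- move=> k; exists ('I_k.+1 * X)%type; first by rewrite card_prod card_ord mulnC.
  exists (@canonical_mono k); apply: span_sub_linear; first exact: linear_set_span.
  move=> _ [u uk <-]; have [p ->] := mono_canonical uk.
  by apply: sub_span; exists p.
Qed.

(* The state [(x, g)] remembers, of the words read so far, their value [x] and
   the map [g] by which they act; reading [u] from [(x0, id)] leads to the value
   and the action of [u]. *)
Definition read_word (p : X * {ffun X -> X}) (u : seq X) : X * {ffun X -> X} :=
  (if u is [::] then p.1 else p.2 (word_value u),
   [ffun y => p.2 (foldr (lam r) y u)]).

Lemma read_word_nil p : read_word p [::] = p.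
Proof. by case: p => x g; congr pair; apply/ffunP => y; rewrite ffunE. Qed.

Lemma read_word_cat p u v : read_word p (u ++ v) = read_word (read_word p u) v.
Proof.
congr pair; last by apply/ffunP => y; rewrite !ffunE foldr_cat.
case: v => [|y v]; first by rewrite cats0.
rewrite word_value_cat //= ffunE.
by case: u.
Qed.

Lemma smcong_read_word p u v : smcong r u v -> read_word p u = read_word p v.
Proof.
move=> uv; congr pair; last first.
  by apply/ffunP => y; rewrite !ffunE (smcong_foldr_lam r_yang_baxter uv).
have := smcong_size uv; case: u v uv => [|x u] [|y v] // uv _.
by rewrite (smcong_word_value r_yang_baxter r_left_nondegenerate r_idempotent x0 uv).
Qed.

Definition start_state : X * {ffun X -> X} := (x0, [ffun y => y]).

Lemma read_word_start u : (read_word start_state u).1 = word_value u.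
Proof. by case: u => //= x u; rewrite ffunE. Qed.

(** * Faithful matrix representation by the action on states *)

Local Notation L := {fraction {poly K}}.
Local Notation tofrac := (@tofrac {poly K}).
(** One less than the number of states, as [representable] asks for matrices of size [n.+1]. *)
Local Notation n := #|{: X * {ffun X -> X}}|.-1.

Lemma card_state : #|{: X * {ffun X -> X}}| = n.+1.
Proof. by rewrite prednK //; apply/card_gt0P; exists start_state. Qed.

Definition state_of (i : 'I_n.+1) : X * {ffun X -> X} :=
  enum_val (cast_ord (esym card_state) i).

Definition rank_of (p : X * {ffun X -> X}) : 'I_n.+1 := cast_ord card_state (enum_rank p).

Lemma rank_ofK : cancel rank_of state_of.
Proof. by move=> p; rewrite /state_of /rank_of cast_ordK enum_rankK. Qed.

Lemma state_ofK : cancel state_of rank_of.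
Proof. by move=> i; rewrite /state_of /rank_of enum_valK cast_ordKV. Qed.

(** Rows index the starting state, so the right action on states gives a map multiplicative in the
    order of concatenation. The power of ['X] separates words of different lengths. *)
Definition read_mx (u : seq X) : 'M[L]_n.+1 :=
  tofrac ('X ^+ size u) *: \matrix_(i, j) (read_word (state_of i) u == state_of j)%:R.

Lemma read_mx_nil : read_mx [::] = 1.
Proof.
rewrite /read_mx expr0 rmorph1 scale1r; apply/matrixP => i j.
by rewrite !mxE read_word_nil (inj_eq (can_inj state_ofK)).
Qed.

Lemma read_mx_cat u v : read_mx (u ++ v) = read_mx u * read_mx v.
Proof.
rewrite /read_mx -scalerAl -scalerAr scalerA size_cat exprD rmorphM; congr (_ *: _).
apply/matrixP => i j; rewrite !mxE.
rewrite (bigD1 (rank_of (read_word (state_of i) u))) //= !mxE rank_ofK eqxx mul1r.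
rewrite -read_word_cat big1 ?addr0 // => k /eqP k_neq; rewrite !mxE.
case: eqP => [k_eq|_]; last by rewrite mul0r.
by case: k_neq; rewrite k_eq state_ofK.
Qed.

Definition frac_const : K -> L := tofrac \o polyC.

HB.instance Definition _ := GRing.RMorphism.on frac_const.

(** Defined on chosen representatives; [struct_mx_mono] shows that any word of the class gives the
    same matrix. *)
Definition struct_mx (a : A) : 'M[L]_n.+1 :=
  mmap (@scalar_mx L n.+1 \o frac_const)
    (fun m : structure_monoid r => read_mx (generic_quotient.repr m)) a.

Lemma struct_mx_zmod_morphism : zmod_morphism struct_mx.
Proof. exact: mmap_is_additive. Qed.

HB.instance Definition _ :=
  GRing.isZmodMorphism.Build A 'M[L]_n.+1 struct_mx struct_mx_zmod_morphism.

Lemma struct_mxZ c a : struct_mx (c *: a) = frac_const c *: struct_mx a.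
Proof.
rewrite /struct_mx (mmapEw (msuppZ_le c a)) mmapE scaler_sumr.
apply: eq_bigr => m _.
by rewrite mcoeffZ /= rmorphM -scale_scalar_mx scalerAl.
Qed.

Lemma struct_mx_mono u : struct_mx (mono u) = read_mx u.
Proof.
rewrite /struct_mx mmapU /= rmorph1 mul1r.
have uE : smcong r (generic_quotient.repr (word_class u)) u by exact: sm_repr.
rewrite /read_mx (smcong_size uE); congr (_ *: _); apply/matrixP => i j.
by rewrite !mxE (smcong_read_word _ uE).
Qed.

Lemma struct_mx_monoid_morphism : GRing.monoid_morphism struct_mx.
Proof.
split; first by rewrite -mono_nil struct_mx_mono read_mx_nil.
move=> a b; move: a; apply: structure_algebra_ind.
  split; first by rewrite mul0r !raddf0 mul0r.
  move=> c a a' aE a'E.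
  by rewrite mulrDl -scalerAl !raddfD /= !struct_mxZ aE a'E mulrDl scalerAl.
move=> u; move: b; apply: structure_algebra_ind.
  split; first by rewrite mulr0 !raddf0 mulr0.
  move=> c a a' aE a'E.
  by rewrite mulrDr -scalerAr !raddfD /= !struct_mxZ aE a'E mulrDr scalerAr.
by move=> v; rewrite -mono_cat !struct_mx_mono read_mx_cat.
Qed.

HB.instance Definition _ :=
  GRing.isMonoidMorphism.Build A 'M[L]_n.+1 struct_mx struct_mx_monoid_morphism.

(* The entry of [struct_mx a] at [(start_state, p)] is the polynomial whose
   coefficients are those of [a] at the words leading from [start_state] to [p];
   such a word is determined by its length. *)
Lemma struct_mx_entry a v : exists2 q : {poly K},
    struct_mx a (rank_of start_state) (rank_of (read_word start_state v)) = tofrac q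
  & q`_(size v) = mcoeff (word_class v) a.
Proof.
move: a; apply: structure_algebra_ind.
  split; first by exists 0; rewrite ?coef0 ?mcoeff0 // raddf0 mxE rmorph0.
  move=> c a b [p pE pv] [q qE qv]; exists (c *: p + q).
    by rewrite raddfD /= struct_mxZ !mxE pE qE -mul_polyC rmorphD rmorphM.
  by rewrite coefD coefZ pv qv mcoeffD mcoeffZ.
move=> u; exists ('X^(size u) *+ (read_word start_state u == read_word start_state v)).
  by rewrite struct_mx_mono !mxE !rank_ofK rmorphMn mulr_natr.
rewrite coefMn coefXn -mulrnA mulnb mcoeff_mono eq_sym; congr (1 *+ nat_of_bool _).
(* For words of equal length, the state reached and the value determine each other: the state
   contains the value, and length and value determine the class. *)
case: eqP => //= suv; apply/eqP/eqP => uv; first by rewrite -!read_word_start uv.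
exact/smcong_read_word/(smcongP r_yang_baxter r_left_nondegenerate r_idempotent x0).
Qed.

Lemma struct_mx_inj : injective struct_mx.
Proof.
apply: raddf_inj => a a0; apply/malgP => m; rewrite mcoeff0.
have <- : word_class (generic_quotient.repr m) = m by exact: reprK.
have [q qE <-] := struct_mx_entry a (generic_quotient.repr m).
move: qE; rewrite [struct_mx a]a0 mxE => /esym/eqP.
by rewrite tofrac_eq0 => /eqP ->; rewrite coef0.
Qed.

Lemma structure_algebra_representable : representable A.
Proof.
exists L, frac_const, n, struct_mx; split; first exact: struct_mx_inj.
exact: struct_mxZ.
Qed.

End StructureAlgebra.

Theorem proposition3p11 (R : realType) (K : fieldType) (X : finType)
    (r : X * X -> X * X)
    (X_nonempty : (0 < #|X|)%N)
    (r_yang_baxter : yang_baxter r)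
    (r_left_nondegenerate : left_nondegenerate r)
    (r_idempotent : idempotent_solution r) :
  (exists B : set (structure_algebra K r),
    [/\ is_subalgebra B, iso_poly1 B & finite_left_module_over B])
  /\ left_noetherian (structure_algebra K r)
  /\ representable (structure_algebra K r)
  /\ satisfies_PI (structure_algebra K r)
  /\ GKdim (structure_algebra K r) R = 1%:E.
Proof.
have [x0 _] := card_gt0P X_nonempty.
have finite_module := structure_algebra_finite_module K r_yang_baxter
  r_left_nondegenerate r_idempotent x0.
have repr_A := structure_algebra_representable K r_yang_baxter
  r_left_nondegenerate r_idempotent x0.
split=> //; split.
  have [B [_ isoB finB]] := finite_module.
  exact: left_noetherian_of_finite isoB finB.
split=> //; split; first exact: representable_PI.
exact: structure_algebra_GKdim.
Qed.
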